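(* Let $(\mathcal{T},\otimes,\Sigma,\mathbb{1})$ be a non-zero monoidal triangulated category, and let $\mathbb{t}$ and $\mathbb{t}_1$ be tensor reduced monoidal t-structures on $\mathcal{T}$. If $\mathbb{t}$ and $\mathbb{t}_1$ are equivalent, then $\mathbb{t}=\mathbb{t}_1$.
   Context: All categories are linear over an algebraically closed field $\mathbb{k}$. A monoidal triangulated category $(\mathcal{T},\otimes,\Sigma,\mathbb{1})$ is a triangulated category with shift $\Sigma$ that is also monoidal with unit $\mathbb{1}$ such that $\otimes$ is exact (triangulated) in each variable; this involves isomorphisms $\Sigma(X)\otimes Y\cong\Sigma(X\otimes Y)\cong X\otimes\Sigma(Y)$ natural in $X,Y$ (no further compatibility is required). A t-structure on $\mathcal{T}$ is a pair of full strict subcategories $\mathbb{t}=(\mathcal{D}^{\leqslant 0},\mathcal{D}^{\geqslant 1})$ with $\Sigma\mathcal{D}^{\leqslant 0}\subseteq\mathcal{D}^{\leqslant 0}$, $\mathcal{D}^{\geqslant 1}\subseteq\Sigma\mathcal{D}^{\geqslant 1}$, $\mathrm{Hom}_{\mathcal{T}}(\mathcal{D}^{\leqslant 0},\mathcal{D}^{\geqslant 1})=0$, and for each $X\in\mathcal{T}$ a distinguished triangle $X^{\leqslant 0}\to X\to X^{\geqslant 1}\to\Sigma X^{\leqslant 0}$ with $X^{\leqslant 0}\in\mathcal{D}^{\leqslant 0}$, $X^{\geqslant 1}\in\mathcal{D}^{\geqslant 1}$. Put $\mathcal{D}^{\leqslant n}:=\Sigma^{-n}\mathcal{D}^{\leqslant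 0}$, $\mathcal{D}^{\geqslant n+1}:=\Sigma^{-n}\mathcal{D}^{\geqslant 1}$; the heart is the abelian category $\mathcal{H}_{\mathbb{t}}:=\mathcal{D}^{\leqslant 0}\cap\mathcal{D}^{\geqslant 0}$. $\mathbb{t}$ is bounded if $\bigcup_n\mathcal{D}^{\leqslant n}=\mathcal{T}=\bigcup_n\mathcal{D}^{\geqslant n}$. Two t-structures $\mathbb{t}=(\mathcal{D}^{\leqslant 0},\mathcal{D}^{\geqslant 1})$ and $\mathbb{t}_1=(\mathcal{D}_1^{\leqslant 0},\mathcal{D}_1^{\geqslant 1})$ are equivalent if there are integers $m\leqslant n$ with $\mathcal{D}^{\leqslant m}\subseteq\mathcal{D}_1^{\leqslant 0}\subseteq\mathcal{D}^{\leqslant n}$. A monoidal t-structure is a bounded t-structure for which there exists $n\in\mathbb{Z}$ with $\mathcal{D}^{\leqslant 0}\otimes\mathcal{D}^{\leqslant n}\subseteq\mathcal{D}^{\leqslant 0}$ and $\mathcal{D}^{\geqslant 0}\otimes\mathcal{D}^{\geqslant n}\subseteq\mathcal{D}^{\geqslant 0}$; the set of all such $n$ is the deviation $\mathrm{dev}(\mathbb{t})$. If $0\in\mathrm{dev}(\mathbb{t})$, then $\mathcal{H}_{\mathbb{t}}$ is a monoidal abelian category under the tensor product of $\mathcal{T}$. A monoidal additive category $\mathcal{C}$ is tensor reduced if for every object $X$, $X\otimes X=0$ if and only if $X=0$. A tensor reduced monoidal t-structure is a monoidal t-structure $\mathbb{t}$ with $0\in\mathrm{dev}(\mathbb{t})$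 whose heart $\mathcal{H}_{\mathbb{t}}$ is tensor reduced. *)

(* Defs.v *)
From mathcomp Require Import all_boot all_order all_algebra.
Set Implicit Arguments.
Unset Strict Implicit.
Unset Printing Implicit Defensive.
Import GRing.Theory.
Local Open Scope ring_scope.

Reserved Notation "g ∘ f" (at level 40, left associativity).
Reserved Notation "X ⊗ Y" (at level 35, right associativity).

Record lincat (k : fieldType) := LinCat {
  ob :> Type;
  hom : ob -> ob -> lmodType k;
  idm : forall X, hom X X;
  comp : forall X Y Z, hom Y Z -> hom X Y -> hom X Z;
  comp_idl : forall X Y (f : hom X Y), comp (idm Y) f = f;
  comp_idr : forall X Y (f : hom X Y), comp f (idm X) = f;
  compA : forall W X Y Z (h : hom Y Z) (g : hom X Y) (f : hom W X),
    comp h (comp g f) = comp (comp h g) f;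
  comp_linl : forall X Y Z (f : hom X Y), linear (fun g : hom Y Z => comp g f);
  comp_linr : forall X Y Z (g : hom Y Z), linear (fun f : hom X Y => comp g f)
}.
Arguments hom {k C} X Y : rename.
Arguments idm {k C} X : rename.
Arguments comp {k C X Y Z} g f : rename.
Notation "g ∘ f" := (comp g f).

Definition is_iso k (C : lincat k) (X Y : C) (f : hom X Y) : Prop :=
  exists g : hom Y X, g ∘ f = idm X /\ f ∘ g = idm Y.

Definition isomorphic k (C : lincat k) (X Y : C) : Prop :=
  exists f : hom X Y, is_iso f.

(* Every hom contains 0, so this says that X is both initial and terminal. *)
Definition is_zero k (C : lincat k) (X : C) : Prop :=
  forall Y : C, (forall f : hom X Y, f = 0) /\ (forall f : hom Y X, f = 0).

Definition is_biproduct k (C : lincat k) (X Y P : C)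
    (iX : hom X P) (iY : hom Y P) (pX : hom P X) (pY : hom P Y) : Prop :=
  [/\ pX ∘ iX = idm X, pY ∘ iY = idm Y, pX ∘ iY = 0, pY ∘ iX = 0
    & iX ∘ pX + iY ∘ pY = idm P].

Definition additive_cat k (C : lincat k) : Prop :=
  (exists Z : C, is_zero Z) /\
  (forall X Y : C, exists (P : C) (iX : hom X P) (iY : hom Y P)
     (pX : hom P X) (pY : hom P Y), is_biproduct iX iY pX pY).

Definition nonzero_cat k (C : lincat k) : Prop := exists X : C, ~ is_zero X.

Record linfunctor k (C D : lincat k) := LinFunctor {
  fob :> C -> D;
  fmap : forall X Y : C, hom X Y -> hom (fob X) (fob Y);
  fmap_id : forall X : C, fmap (idm X) = idm (fob X);
  fmap_comp : forall (X Y Z : C) (g : hom Y Z) (f : hom X Y),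
    fmap (g ∘ f) = fmap g ∘ fmap f;
  fmap_linear : forall X Y : C, linear (@fmap X Y)
}.
Arguments fmap {k C D} F {X Y} f : rename.

(* The shift is an autoequivalence, with a chosen quasi-inverse unshift.
   The axioms TR1-TR4 are those of Verdier. *)
Record tricat (k : fieldType) := TriCat {
  tri_cat :> lincat k;
  tri_additive : additive_cat tri_cat;

  shift : linfunctor tri_cat tri_cat;
  unshift : linfunctor tri_cat tri_cat;
  unshiftK : forall X : tri_cat, hom (unshift (shift X)) X;
  unshiftK_iso : forall X, is_iso (unshiftK X);
  unshiftK_nat : forall (X Y : tri_cat) (f : hom X Y),
    f ∘ unshiftK X = unshiftK Y ∘ fmap unshift (fmap shift f);
  shiftK : forall X : tri_cat, hom (shift (unshift X)) X;
  shiftK_iso : forall X, is_iso (shiftK X);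
  shiftK_nat : forall (X Y : tri_cat) (f : hom X Y),
    f ∘ shiftK X = shiftK Y ∘ fmap shift (fmap unshift f);

  distinguished : forall X Y Z : tri_cat,
    hom X Y -> hom Y Z -> hom Z (shift X) -> Prop;

  tr1_iso : forall (X Y Z X' Y' Z' : tri_cat)
    (f : hom X Y) (g : hom Y Z) (h : hom Z (shift X))
    (f' : hom X' Y') (g' : hom Y' Z') (h' : hom Z' (shift X'))
    (a : hom X X') (b : hom Y Y') (c : hom Z Z'),
    is_iso a -> is_iso b -> is_iso c ->
    b ∘ f = f' ∘ a -> c ∘ g = g' ∘ b -> fmap shift a ∘ h = h' ∘ c ->
    distinguished f g h -> distinguished f' g' h';
  tr1_id : forall X Z : tri_cat, is_zero Z ->
    distinguished (idm X) (0 : hom X Z) 0;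
  tr1_cone : forall (X Y : tri_cat) (f : hom X Y),
    exists (Z : tri_cat) (g : hom Y Z) (h : hom Z (shift X)),
      distinguished f g h;
  tr2 : forall (X Y Z : tri_cat)
    (f : hom X Y) (g : hom Y Z) (h : hom Z (shift X)),
    distinguished f g h <-> distinguished g h (- fmap shift f);
  tr3 : forall (X Y Z X' Y' Z' : tri_cat)
    (f : hom X Y) (g : hom Y Z) (h : hom Z (shift X))
    (f' : hom X' Y') (g' : hom Y' Z') (h' : hom Z' (shift X'))
    (a : hom X X') (b : hom Y Y'),
    distinguished f g h -> distinguished f' g' h' -> b ∘ f = f' ∘ a ->
    exists c : hom Z Z', c ∘ g = g' ∘ b /\ fmap shift a ∘ h = h' ∘ c;
  tr4 : forall (X Y Z X' Y' Z' : tri_cat) (f : hom X Y) (g : hom Y Z)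
    (i : hom Y Z') (i' : hom Z' (shift X))
    (j : hom Z X') (j' : hom X' (shift Y))
    (l : hom Z Y') (l' : hom Y' (shift X)),
    distinguished f i i' -> distinguished g j j' ->
    distinguished (g ∘ f) l l' ->
    exists (u : hom Z' Y') (v : hom Y' X'),
      [/\ distinguished u v (fmap shift i ∘ j'),
          u ∘ i = l ∘ g, l' ∘ u = i', v ∘ l = j & j' ∘ v = fmap shift f ∘ l']
}.
Arguments shift {k} T : rename.
Arguments unshift {k} T : rename.
Arguments distinguished {k T X Y Z} f g h : rename.

Record montricat (k : fieldType) := MonTriCat {
  mt_tri :> tricat k;

  tens : mt_tri -> mt_tri -> mt_tri;
  tensm : forall X X' Y Y' : mt_tri,
    hom X X' -> hom Y Y' -> hom (tens X Y) (tens X' Y');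
  tensm_id : forall X Y, tensm (idm X) (idm Y) = idm (tens X Y);
  tensm_comp : forall (X X' X'' Y Y' Y'' : mt_tri)
    (f : hom X X') (f' : hom X' X'') (g : hom Y Y') (g' : hom Y' Y''),
    tensm (f' ∘ f) (g' ∘ g) = tensm f' g' ∘ tensm f g;
  tensm_linl : forall (X X' Y Y' : mt_tri) (g : hom Y Y'),
    linear (fun f : hom X X' => tensm f g);
  tensm_linr : forall (X X' Y Y' : mt_tri) (f : hom X X'),
    linear (fun g : hom Y Y' => tensm f g);

  tens1 : mt_tri;
  tassoc : forall X Y Z, hom (tens (tens X Y) Z) (tens X (tens Y Z));
  tassoc_iso : forall X Y Z, is_iso (tassoc X Y Z);
  tassoc_nat : forall (X X' Y Y' Z Z' : mt_tri)
    (f : hom X X') (g : hom Y Y') (h : hom Z Z'),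
    tassoc X' Y' Z' ∘ tensm (tensm f g) h
      = tensm f (tensm g h) ∘ tassoc X Y Z;
  tlunit : forall X, hom (tens tens1 X) X;
  tlunit_iso : forall X, is_iso (tlunit X);
  tlunit_nat : forall (X Y : mt_tri) (f : hom X Y),
    f ∘ tlunit X = tlunit Y ∘ tensm (idm tens1) f;
  trunit : forall X, hom (tens X tens1) X;
  trunit_iso : forall X, is_iso (trunit X);
  trunit_nat : forall (X Y : mt_tri) (f : hom X Y),
    f ∘ trunit X = trunit Y ∘ tensm f (idm tens1);
  tpentagon : forall W X Y Z : mt_tri,
    tensm (idm W) (tassoc X Y Z) ∘ tassoc W (tens X Y) Z
        ∘ tensm (tassoc W X Y) (idm Z)
      = tassoc W X (tens Y Z) ∘ tassoc (tens W X) Y Z;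
  ttriangle : forall X Y : mt_tri,
    tensm (idm X) (tlunit Y) ∘ tassoc X tens1 Y = tensm (trunit X) (idm Y);

  tshiftl : forall X Y, hom (tens (shift mt_tri X) Y) (shift mt_tri (tens X Y));
  tshiftl_iso : forall X Y, is_iso (tshiftl X Y);
  tshiftl_nat : forall (X X' Y Y' : mt_tri) (f : hom X X') (g : hom Y Y'),
    tshiftl X' Y' ∘ tensm (fmap (shift mt_tri) f) g
      = fmap (shift mt_tri) (tensm f g) ∘ tshiftl X Y;
  tshiftr : forall X Y, hom (tens X (shift mt_tri Y)) (shift mt_tri (tens X Y));
  tshiftr_iso : forall X Y, is_iso (tshiftr X Y);
  tshiftr_nat : forall (X X' Y Y' : mt_tri) (f : hom X X') (g : hom Y Y'),
    tshiftr X' Y' ∘ tensm f (fmap (shift mt_tri) g)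
      = fmap (shift mt_tri) (tensm f g) ∘ tshiftr X Y;
  tens_exactl : forall (X Y Z W : mt_tri)
    (f : hom X Y) (g : hom Y Z) (h : hom Z (shift mt_tri X)),
    distinguished f g h ->
    distinguished (tensm f (idm W)) (tensm g (idm W))
                  (tshiftl X W ∘ tensm h (idm W));
  tens_exactr : forall (X Y Z W : mt_tri)
    (f : hom X Y) (g : hom Y Z) (h : hom Z (shift mt_tri X)),
    distinguished f g h ->
    distinguished (tensm (idm W) f) (tensm (idm W) g)
                  (tshiftr W X ∘ tensm (idm W) h)
}.
Arguments tens {k T} X Y : rename.
Notation "X ⊗ Y" := (tens X Y).

(* Full subcategories are given by predicates on objects. *)
Definition subcat k (T : tricat k) := T -> Prop.

Definition sub_le k (T : tricat k) (A B : subcat T) : Prop :=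
  forall X : T, A X -> B X.

Definition strict k (T : tricat k) (A : subcat T) : Prop :=
  forall X Y : T, isomorphic X Y -> A X -> A Y.

Definition shiftz k (T : tricat k) (n : int) (X : T) : T :=
  match n with
  | Posz m => iter m (shift T) X
  | Negz m => iter m.+1 (unshift T) X
  end.

(* Closed under isomorphism, as the subcategories considered are strict. *)
Definition shift_sub k (T : tricat k) (n : int) (A : subcat T) : subcat T :=
  fun X => exists Y : T, A Y /\ isomorphic X (shiftz n Y).

Record tpair k (T : tricat k) := TPair { le0 : subcat T; ge1 : subcat T }.

Definition is_tstructure k (T : tricat k) (t : tpair T) : Prop :=
  [/\ strict (le0 t) /\ strict (ge1 t),
      sub_le (shift_sub 1 (le0 t)) (le0 t),
      sub_le (ge1 t) (shift_sub 1 (ge1 t)),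
      forall X Y : T, le0 t X -> ge1 t Y -> forall f : hom X Y, f = 0
    & forall X : T, exists (A B : T)
        (f : hom A X) (g : hom X B) (h : hom B (shift T A)),
        [/\ le0 t A, ge1 t B & distinguished f g h]].

Definition len k (T : tricat k) (t : tpair T) (n : int) : subcat T :=
  shift_sub (- n) (le0 t).

Definition gen k (T : tricat k) (t : tpair T) (n : int) : subcat T :=
  shift_sub (1 - n) (ge1 t).

Definition heart k (T : tricat k) (t : tpair T) : subcat T :=
  fun X => le0 t X /\ gen t 0 X.

Definition bounded_tstructure k (T : tricat k) (t : tpair T) : Prop :=
  [/\ is_tstructure t, forall X : T, exists n : int, len t n X
    & forall X : T, exists n : int, gen t n X].

Definition tequivalent k (T : tricat k) (t t1 : tpair T) : Prop :=
  exists m n : int, [/\ m <= n, sub_le (len t m) (le0 t1)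
                      & sub_le (le0 t1) (len t n)].

Definition tens_sub k (T : montricat k) (A B C : subcat T) : Prop :=
  forall X Y : T, A X -> B Y -> C (X ⊗ Y).

Definition dev k (T : montricat k) (t : tpair T) (n : int) : Prop :=
  tens_sub (le0 t) (len t n) (le0 t) /\ tens_sub (gen t 0) (gen t n) (gen t 0).

Definition monoidal_tstructure k (T : montricat k) (t : tpair T) : Prop :=
  bounded_tstructure t /\ exists n : int, dev t n.

(* An object of a full subcategory is zero there iff it is zero in T, both
   meaning that its identity vanishes. *)
Definition tensor_reduced k (T : montricat k) (A : subcat T) : Prop :=
  forall X : T, A X -> (is_zero (X ⊗ X) <-> is_zero X).

Definition tensor_reduced_tstructure k (T : montricat k) (t : tpair T) : Prop :=
  [/\ monoidal_tstructure t, dev t 0 & tensor_reduced (heart t)].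

(* Main.v *)
From Pilot Require Import Defs.
From mathcomp Require Import all_boot all_order all_algebra.
From Stdlib Require Import FunctionalExtensionality PropExtensionality.

(** Write U and V for the two halves [le0 t] and [ge1 t] of a t-structure, and
    U1 for [le0 t1].  As each half of a t-structure is the orthogonal of the
    other, it is enough to prove U = U1, and by symmetry the inclusion of U1 in
    U.

    Equivalence gives an n with U1 inside D^{<= n}, and the point is that tensor
    squares force n down to 0.  Suppose n > 0 and let X be in U1.  The top
    cohomology of a tensor product is the tensor product of the top
    cohomologies, so that H^n(X) ⊗ H^n(X) = H^{2n}(X ⊗ X).  But U1 is closed
    under ⊗, hence X ⊗ X lies in U1, hence in D^{<= n}, and its cohomology in
    degree 2n > n vanishes.  The heart of t being tensor reduced, H^n(X) = 0,
    that is, X lies in D^{<= n-1}.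

    Replacing X by its shift Y = Σ^{n-1} X, this step becomes
    [le0_of_tens_square]: if Σ Y and Σ (Y ⊗ Y) lie in U, then so does Y.  There
    the cohomology functors do not appear: H^n(X) is Σ B for the truncation
    triangle A -> Y -> B of Y, and the vanishing of its tensor square follows
    from closure of U under extensions in the triangles obtained by tensoring.
    Besides rotation, the only fact about triangles behind all this is the weak
    cokernel property [triangle_factor]. *)

Set Implicit Arguments.
Unset Strict Implicit.
Unset Printing Implicit Defensive.
Import GRing.Theory.
(* [hom] is again a module of morphisms, not of linear maps. *)
Import Pilot.Defs.
Local Open Scope ring_scope.

(** * Linear categories: isomorphisms and zero objects *)

Section LinearMaps.
Variables (k : fieldType) (U V : lmodType k) (f : U -> V).
Hypothesis fL : linear f.

Lemma linear_map0 : f 0 = 0.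
Proof. by have := fL (-1) 0 0; rewrite scaler0 add0r scaleN1r addNr. Qed.

Lemma linear_mapB u v : f (u - v) = f u - f v.
Proof. by rewrite addrC -scaleN1r fL scaleN1r addrC. Qed.

End LinearMaps.

Section LinearCategories.
Variables (k : fieldType) (C : lincat k).
Implicit Types X Y Z : C.

Lemma comp0l X Y Z (f : hom X Y) : (0 : hom Y Z) ∘ f = 0.
Proof. exact: linear_map0 (@comp_linl _ _ _ _ Z f). Qed.

Lemma comp0r X Y Z (g : hom Y Z) : g ∘ (0 : hom X Y) = 0.
Proof. exact: linear_map0 (@comp_linr _ _ X _ _ g). Qed.

Lemma compBl X Y Z (f : hom X Y) (g h : hom Y Z) :
  (g - h) ∘ f = g ∘ f - h ∘ f.
Proof. exact: linear_mapB (@comp_linl _ _ _ _ Z f) _ _. Qed.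

Lemma compBr X Y Z (f g : hom X Y) (h : hom Y Z) :
  h ∘ (f - g) = h ∘ f - h ∘ g.
Proof. exact: linear_mapB (@comp_linr _ _ X _ _ h) _ _. Qed.

Lemma is_iso_comp X Y Z (f : hom X Y) (g : hom Y Z) :
  is_iso f -> is_iso g -> is_iso (g ∘ f).
Proof.
move=> [f' [f'f ff']] [g' [g'g gg']]; exists (f' ∘ g'); split.
  by rewrite -compA [g' ∘ _]compA g'g comp_idl.
by rewrite -compA [f ∘ _]compA ff' comp_idl.
Qed.

Lemma isomorphic_refl X : isomorphic X X.
Proof. by exists (idm X), (idm X); rewrite comp_idl. Qed.

Lemma isomorphic_sym X Y : isomorphic X Y -> isomorphic Y X.
Proof. by move=> [f [g [gf fg]]]; exists g, f. Qed.

Lemma isomorphic_trans Y X Z :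
  isomorphic X Y -> isomorphic Y Z -> isomorphic X Z.
Proof. by move=> [f fI] [g gI]; exists (g ∘ f); apply: is_iso_comp. Qed.

Lemma is_zeroP X : is_zero X <-> idm X = 0.
Proof.
split=> [X0 | id0 Y]; first exact: (X0 X).1.
split=> f; first by rewrite -[f]comp_idr id0 comp0r.
by rewrite -[f]comp_idl id0 comp0l.
Qed.

Lemma is_zero_isomorphic X Y : isomorphic X Y -> is_zero X -> is_zero Y.
Proof.
move=> [f [g [_ fg]]] /is_zeroP X0; apply/is_zeroP.
by rewrite -fg -[f]comp_idr X0 comp0r comp0l.
Qed.

End LinearCategories.

Section LinearFunctors.
Variables (k : fieldType) (C D : lincat k) (F : linfunctor C D).
Implicit Types X Y : C.

Lemma fmap0 X Y : fmap F (0 : hom X Y) = 0.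
Proof. exact: linear_map0 (@fmap_linear _ _ _ F X Y). Qed.

Lemma isomorphic_fob X Y : isomorphic X Y -> isomorphic (fob F X) (fob F Y).
Proof.
move=> [f [g [gf fg]]]; exists (fmap F f), (fmap F g).
by rewrite -!fmap_comp gf fg !fmap_id.
Qed.

Lemma is_zero_fob X : is_zero X -> is_zero (fob F X).
Proof. by move=> /is_zeroP X0; apply/is_zeroP; rewrite -fmap_id X0 fmap0. Qed.

End LinearFunctors.

(** * Triangulated categories *)

Section Triangles.
Variables (k : fieldType) (T : tricat k).
Implicit Types X Y Z W : T.
Local Notation S := (shift T).
Local Notation S' := (unshift T).
Local Notation "S ^^ n" := (iter n (fob S)) (at level 9, n at level 9).

Lemma unshift_shift X : isomorphic (S' (S X)) X.
Proof. by exists (unshiftK X); apply: unshiftK_iso. Qed.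

Lemma shift_unshift X : isomorphic (S (S' X)) X.
Proof. by exists (shiftK X); apply: shiftK_iso. Qed.

Lemma isomorphic_shift_inj X Y : isomorphic (S X) (S Y) -> isomorphic X Y.
Proof.
move=> /(isomorphic_fob S') SXY.
apply: isomorphic_trans (isomorphic_sym (unshift_shift X)) _.
exact: isomorphic_trans SXY (unshift_shift Y).
Qed.

Lemma is_zero_shift_inj X : is_zero (S X) -> is_zero X.
Proof.
by move=> /(is_zero_fob S'); apply: is_zero_isomorphic (unshift_shift X).
Qed.

Lemma isomorphic_iter_shift n X Y :
  isomorphic X Y -> isomorphic (S^^n X) (S^^n Y).
Proof. by elim: n => //= n IHn XY; apply/isomorphic_fob/IHn. Qed.

Lemma iter_shift_unshift n X : isomorphic (S^^n (iter n (fob S') X)) X.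
Proof.
elim: n X => [|n IHn] X; first exact: isomorphic_refl.
rewrite [iter _ (fob S') _]iterS iterSr.
exact: isomorphic_trans (isomorphic_iter_shift n (shift_unshift _)) (IHn X).
Qed.

Lemma iter_unshift_shift n X : isomorphic (iter n (fob S') (S^^n X)) X.
Proof.
elim: n X => [|n IHn] X; first exact: isomorphic_refl.
rewrite iterS [iter n.+1 (fob S) X]iterSr.
exact: isomorphic_trans (isomorphic_fob S' (IHn (S X))) (unshift_shift X).
Qed.

(** Each morphism of a triangle is a weak cokernel of the preceding one: a
    morphism that kills [f] extends to a morphism from the triangle to the
    triangle 0 -> W -> W -> 0. *)
Lemma triangle_factor X Y Z W (f : hom X Y) (g : hom Y Z) (h : hom Z (S X))
    (u : hom Y W) :
  distinguished f g h -> u ∘ f = 0 -> exists r : hom Z W, u = r ∘ g.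
Proof.
move=> fgh uf0; have [[O O0] _] := tri_additive T.
have OW : distinguished (0 : hom O W) (idm W) (0 : hom W (S O)).
  by apply/tr2; rewrite fmap0 oppr0; apply: tr1_id; apply: is_zero_fob.
have [|r [rg _]] := tr3 (a := 0) (b := u) fgh OW; first by rewrite uf0 comp0r.
by exists r; rewrite rg comp_idl.
Qed.

Lemma triangle_shift X Y Z (f : hom X Y) (g : hom Y Z) (h : hom Z (S X)) :
  distinguished f g h ->
  distinguished (- fmap S f) (- fmap S g) (- fmap S h).
Proof. by move=> fgh; do 3 apply/(proj1 (tr2 _ _ _)). Qed.

(** A retraction r of [g] exists since [f] vanishes.  The defect id - g r
    kills [g], so it factors through a morphism from S X to Z. *)
Lemma triangle_iso X Y Z (f : hom X Y) (g : hom Y Z) (h : hom Z (S X)) :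
  distinguished f g h -> f = 0 -> (forall s : hom (S X) Z, s = 0) -> is_iso g.
Proof.
move=> fgh f0 XZ0.
have [|r rg] := triangle_factor (u := idm Y) fgh; first by rewrite f0 comp0r.
have [|s sh] := triangle_factor (u := idm Z - g ∘ r) (proj1 (tr2 _ _ _) fgh).
  by rewrite compBl -compA -rg comp_idl comp_idr subrr.
exists r; split=> //; apply/esym/eqP.
by rewrite -subr_eq0 sh (XZ0 s) comp0l.
Qed.

(** In the triangle rotated twice, S X -> S Y is the second morphism, so that
    [triangle_iso] applies to it. *)
Lemma triangle_isomorphic X Y Z (f : hom X Y) (g : hom Y Z) (h : hom Z (S X)) :
  distinguished f g h -> is_zero Z -> isomorphic X Y.
Proof.
move=> fgh Z0; apply: isomorphic_shift_inj; exists (- fmap S f).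
apply: triangle_iso (proj1 (tr2 _ _ _) (proj1 (tr2 _ _ _) fgh)) _ _.
  exact: (Z0 _).1.
by move=> s; apply: (is_zero_fob S Z0 _).1.
Qed.

(** * t-structures *)

Section TStructure.
Variable t : tpair T.
Hypothesis tP : is_tstructure t.

Lemma le0_isomorphic X Y : isomorphic X Y -> le0 t X -> le0 t Y.
Proof. by case: tP => [[leS _] _ _ _ _]; apply: leS. Qed.

Lemma ge1_isomorphic X Y : isomorphic X Y -> ge1 t X -> ge1 t Y.
Proof. by case: tP => [[_ geS] _ _ _ _]; apply: geS. Qed.

Lemma hom_le0_ge1 X Y (f : hom X Y) : le0 t X -> ge1 t Y -> f = 0.
Proof. by case: tP => [_ _ _ ort _] ? ?; apply: ort. Qed.

Lemma le0_shift X : le0 t X -> le0 t (S X).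
Proof.
case: tP => [_ leS _ _ _] leX; apply: leS; exists X.
by split=> //; apply: isomorphic_refl.
Qed.

Lemma le0_iter_shift n X : le0 t X -> le0 t (S^^n X).
Proof. by elim: n => //= n IHn leX; apply/le0_shift/IHn. Qed.

Lemma le0_ge1_is_zero X : le0 t X -> ge1 t X -> is_zero X.
Proof. by move=> leX geX; apply/is_zeroP; apply: hom_le0_ge1. Qed.

(** The truncation triangle A -> X -> B of X has A -> X equal to zero, and no
    nonzero morphism from the shift of A to B; hence X -> B is invertible. *)
Lemma ge1P X :
  ge1 t X <-> (forall Y, le0 t Y -> forall f : hom Y X, f = 0).
Proof.
split=> [geX Y leY f | ortX]; first exact: hom_le0_ge1.
case: (tP) => [_ _ _ _ /(_ X) [A [B [f [g [h [leA geB fgh]]]]]]].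
have gI : is_iso g.
  apply: triangle_iso fgh (ortX _ leA f) _ => s.
  exact: hom_le0_ge1 (le0_shift leA) geB.
by apply: ge1_isomorphic geB; apply: isomorphic_sym; exists g.
Qed.

(** The identity of the truncation B of X in [ge1 t] kills X -> B, hence
    factors through the shift of an object of [le0 t], hence vanishes. *)
Lemma le0P X :
  le0 t X <-> (forall Y, ge1 t Y -> forall f : hom X Y, f = 0).
Proof.
split=> [leX Y geY f | ortX]; first exact: hom_le0_ge1.
case: (tP) => [_ _ _ _ /(_ X) [A [B [f [g [h [leA geB fgh]]]]]]].
have B0 : is_zero B.
  apply/is_zeroP.
  have [|s ->] := triangle_factor (u := idm B) (proj1 (tr2 _ _ _) fgh).
    by rewrite (ortX _ geB g) comp0r.
  by rewrite (hom_le0_ge1 s (le0_shift leA) geB) comp0l.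
exact: le0_isomorphic (triangle_isomorphic fgh B0) leA.
Qed.

Lemma le0_extension X Y Z (f : hom X Y) (g : hom Y Z) (h : hom Z (S X)) :
  distinguished f g h -> le0 t X -> le0 t Z -> le0 t Y.
Proof.
move=> fgh leX leZ; apply/le0P => W geW u.
have [|r ->] := triangle_factor (u := u) fgh; first exact: hom_le0_ge1.
by rewrite (hom_le0_ge1 r leZ geW) comp0l.
Qed.

Lemma le0_shift_cone X Y Z (f : hom X Y) (g : hom Y Z) (h : hom Z (S X)) :
  distinguished f g h -> le0 t (S Y) -> le0 t (S (S X)) -> le0 t (S Z).
Proof.
by move=> /triangle_shift/(proj1 (tr2 _ _ _)); apply: le0_extension.
Qed.

Lemma len0 X : le0 t X -> len t 0 X.
Proof. by move=> leX; exists X; split=> //; apply: isomorphic_refl. Qed.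

Lemma gen0 X : ge1 t X -> gen t 0 (S X).
Proof. by move=> geX; exists X; split=> //; apply: isomorphic_refl. Qed.

Lemma len_iter_shift (m : int) :
  exists n, forall X, len t m X -> le0 t (S^^n X).
Proof.
case: m => [m|m].
  exists m => X [Y [leY XY]].
  apply: le0_isomorphic leY; apply: isomorphic_sym.
  apply: isomorphic_trans (isomorphic_iter_shift m XY) _.
  (* The shift by - m reduces only once m is zero or a successor. *)
  case: m {XY} => [|m]; first exact: isomorphic_refl.
  exact: iter_shift_unshift m.+1 Y.
exists 0%N => X [Y [leY XY]].
by apply: le0_isomorphic (isomorphic_sym XY) (le0_iter_shift m.+1 leY).
Qed.

Lemma iter_shift_len (m : int) :
  exists n, forall X, le0 t X -> len t m (S^^n X).
Proof.
case: m => m; last first.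
  by exists m.+1 => X leX; exists X; split=> //; apply: isomorphic_refl.
exists 0%N => X leX; exists (S^^m X); split; first exact: le0_iter_shift.
case: m => [|m]; first exact: isomorphic_refl.
exact: isomorphic_sym (iter_unshift_shift m.+1 X).
Qed.

End TStructure.

Lemma tstructure_eq (t t1 : tpair T) :
  is_tstructure t -> is_tstructure t1 ->
  sub_le (le0 t) (le0 t1) -> sub_le (le0 t1) (le0 t) -> t = t1.
Proof.
move=> tP t1P le01 le10.
have leE : le0 t = le0 t1.
  apply: functional_extensionality => X; apply: propositional_extensionality.
  by split; [apply: le01 | apply: le10].
have geE : ge1 t = ge1 t1.
  apply: functional_extensionality => X; apply: propositional_extensionality.
  by rewrite (ge1P tP) (ge1P t1P) leE.
by case: t t1 leE geE {tP t1P le01 le10} => [U V] [U1 V1] /= -> ->.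
Qed.

End Triangles.

(** * Tensor products and t-structures *)

Section MonoidalTStructure.
Variables (k : fieldType) (T : montricat k).
Implicit Types X Y : T.
Local Notation S := (shift T).
Local Notation "S ^^ n" := (iter n (fob S)) (at level 9, n at level 9).

Lemma tens_iter_shift a b X Y :
  isomorphic (S^^a X ⊗ S^^b Y) (S^^(a + b)%N (X ⊗ Y)).
Proof.
elim: a => [|a IHa] /=.
  elim: b => [|b IHb] /=; first exact: isomorphic_refl.
  apply: isomorphic_trans (isomorphic_fob S IHb).
  by exists (tshiftr X (S^^b Y)); apply: tshiftr_iso.
apply: isomorphic_trans (isomorphic_fob S IHa).
by exists (tshiftl (S^^a X) (S^^b Y)); apply: tshiftl_iso.
Qed.

Section Deviation.
Variable t : tpair T.
Hypotheses (tP : is_tstructure t) (dev0 : dev t 0).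

Lemma le0_tens X Y : le0 t X -> le0 t Y -> le0 t (X ⊗ Y).
Proof. by move=> leX leY; apply: dev0.1 => //; apply: len0. Qed.

(** With A -> Y -> B the truncation triangle of Y, the object S B is the top
    cohomology of Y.  The triangles obtained by tensoring with Y and with B
    carry S (Y ⊗ Y) in [le0 t] to S (B ⊗ B) in [le0 t], whereas the tensor
    square S B ⊗ S B of an object of the heart lies in the shift of [ge1 t].
    So S (B ⊗ B) is in both halves, the tensor square of S B vanishes, and B
    with it, the heart being tensor reduced. *)
Lemma le0_of_tens_square Y :
  tensor_reduced (heart t) ->
  le0 t (S Y) -> le0 t (S (Y ⊗ Y)) -> le0 t Y.
Proof.
move=> red leSY leSYY.
case: (tP) => [_ _ _ _ /(_ Y) [A [B [f [g [h [leA geB fgh]]]]]]].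
have leSB : le0 t (S B).
  by apply: (le0_shift_cone tP fgh leSY); do 2 apply: (le0_shift tP).
have leSBY : le0 t (S (B ⊗ Y)).
  apply: (le0_shift_cone tP (tens_exactl Y fgh) leSYY).
  apply: (le0_isomorphic tP (tens_iter_shift 1 1 A Y)).
  by apply: le0_tens => //; apply: (le0_shift tP).
have leSBB : le0 t (S (B ⊗ B)).
  apply: (le0_shift_cone tP (tens_exactr B fgh) leSBY).
  apply: (le0_isomorphic tP (tens_iter_shift 1 1 B A)).
  by apply: le0_tens => //; apply: (le0_shift tP).
have SBB := tens_iter_shift 1 1 B B.
have [W [geW SBBW]] : gen t 0 (S B ⊗ S B) by apply: dev0.2; apply: gen0.
have BBW : isomorphic (S (B ⊗ B)) W.
  apply: isomorphic_shift_inj.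
  exact: isomorphic_trans (isomorphic_sym SBB) SBBW.
have W0 : is_zero W.
  exact: (le0_ge1_is_zero tP (le0_isomorphic tP BBW leSBB) geW).
have B0 : is_zero B.
  apply: is_zero_shift_inj; apply/(red (S B)); first by split=> //; apply: gen0.
  by apply: is_zero_isomorphic (isomorphic_sym SBBW) _; apply: is_zero_fob.
exact: (le0_isomorphic tP (triangle_isomorphic fgh B0) leA).
Qed.

End Deviation.

(** Descent on the width n of the inclusion; each step is
    [le0_of_tens_square] at Y = S^^n X, whose tensor square is the 2n-th shift
    of the object X ⊗ X of [le0 t1]. *)
Lemma le0_sub_of_iter_shift (t t1 : tpair T) n :
  is_tstructure t -> dev t 0 -> tensor_reduced (heart t) ->
  dev t1 0 ->
  (forall X, le0 t1 X -> le0 t (S^^n X)) -> sub_le (le0 t1) (le0 t).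
Proof.
move=> tP dev0 red dev10; elim: n => [|n IHn] le1 //.
apply: IHn => X le1X; apply: (le0_of_tens_square tP dev0 red (le1 X le1X)).
have leSXX := le0_iter_shift tP n (le1 _ (le0_tens dev10 le1X le1X)).
apply: (le0_isomorphic tP _ leSXX); apply: isomorphic_sym.
rewrite -iterD addnS iterS.
exact: isomorphic_fob (tens_iter_shift n n X X).
Qed.

End MonoidalTStructure.

Theorem theorem2p23 (k : closedFieldType) (T : montricat k) (t t1 : tpair T)
    (hT : nonzero_cat T)
    (ht : tensor_reduced_tstructure t) (ht1 : tensor_reduced_tstructure t1)
    (heq : tequivalent t t1) :
  t = t1.
Proof.
have [[[tP _ _] _] dev0 red] := ht.
have [[[t1P _ _] _] dev10 red1] := ht1.
have [m [n [_ len_le1 le1_len]]] := heq.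
apply: tstructure_eq => //.
  have [p pP] := iter_shift_len tP m.
  by apply: (@le0_sub_of_iter_shift _ _ t1 t p) => // X /pP/len_le1.
have [q qP] := len_iter_shift tP n.
by apply: (@le0_sub_of_iter_shift _ _ t t1 q) => // X /le1_len/qP.
Qed.
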